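(* Assume $\sum_{\ell=1}^{N_{\mathrm{HVAC}}}P_\ell > P_{\mathrm{total},t}^{(N)}$. Let $k=\lfloor \alpha_t N\rfloor$. Then the distributionally robust chance constraint $$\inf_{f\in\mathcal D_t^2}\mathbb P_f\Big(\sum_{\ell=1}^{N_{\mathrm{HVAC}}}P_\ell u_{t,\ell}-\sum_{i=1}^{N_{\mathrm{PV}}}\widetilde P_{\mathrm{PV},t,i}\ge 0\Big)\ge 1-\alpha_t$$ on the decision $u_t\in\{0,1\}^{N_{\mathrm{HVAC}}}$ is feasible (satisfied by $u_t$) if and only if the following linear constraints are feasible with auxiliary variables $a_n$ and $h_n\in\{0,1\}$, $n=1,\ldots,k+1$: $$\frac1N\sum_{n=1}^{k}a_n+\Big(\alpha_t-\frac kN\Big)a_{k+1}\ge\delta_t,$$ $$a_n\le\sum_{\ell=1}^{N_{\mathrm{HVAC}}}P_\ell u_{t,\ell}-P_{\mathrm{total},t}^{(n)}+M_n^2(1-h_n),\quad n=1,\ldots,k+1,$$ $$a_n\le M_n h_n,\quad n=1,\ldots,k+1,$$ $$h_n\in\{0,1\},\quad a_n\ge0,\quad n=1,\ldots,k+1,$$ where $M_n$ and $M_n^2$ are sufficiently large big-M constants (the superscript 2 in $M_n^2$ is a label, not a square).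
   Context: $N_{\mathrm{HVAC}},N_{\mathrm{PV}},N\ge1$ are integers; $t$ is a fixed period; $P_\ell$ is the energy consumption of unit $\ell$ during one period when it is ON; $u_{t,\ell}\in\{0,1\}$ is the ON/OFF decision for unit $\ell$ and $u_t=(u_{t,\ell})_\ell$; $\alpha_t\in(0,1)$ is a given risk level and $\delta_t>0$ a given radius. $\widetilde P_{\mathrm{PV},t}$ is a random vector in $\mathbb R^{N_{\mathrm{PV}}}$ with distribution $f$, and $\mathbb P_f$ is probability under $f$. Samples $P^1_{\mathrm{PV},t},\ldots,P^N_{\mathrm{PV},t}\in\mathbb R^{N_{\mathrm{PV}}}$ are given, with empirical distribution $\mathbb P^N$ giving mass $1/N$ to each sample. The Wasserstein ambiguity set is $\mathcal D_t^2=\{f:\ \mathbb P_f(\widetilde P_{\mathrm{PV},t}\in\mathbb R^{N_{\mathrm{PV}}})=1,\ W(\mathbb P_f,\mathbb P^N)\le\delta_t\}$, where $W(\mathbb P_1,\mathbb P_2)=\inf_{\mathbb Q}\int\|\xi^1-\xi^2\|\,\mathbb Q(d\xi^1,d\xi^2)$, the infimum being over all joint distributions $\mathbb Q$ on $\mathbb R^{N_{\mathrm{PV}}}\times\mathbb R^{N_{\mathrm{PV}}}$ with marginals $\mathbb P_1,\mathbb P_2$, and $\|\cdot\|$ is a norm on $\mathbb R^{N_{\mathrm{PV}}}$ (not further specified). Put $P^n_{\mathrm{total},t}=\mathbf 1^\top P^n_{\mathrm{PV},t}$, where $\mathbf 1$ is the all-ones vector, and let $P_{\mathrm{total},t}^{(1)}\ge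 P_{\mathrm{total},t}^{(2)}\ge\cdots\ge P_{\mathrm{total},t}^{(N)}$ be these values sorted in non-increasing order.
   Formalization: The norm is assumed to have dual norm of the all-ones vector equal to 1 (as the 1-norm does); for other norms the stated equivalence is false, since the first constraint would need δ_t multiplied by that dual norm. *)

(* Defs.v *)
From HB Require Import structures.
From mathcomp Require Export all_boot all_order all_algebra.
From mathcomp Require Export all_classical all_reals all_analysis.
Export Order.TTheory GRing.Theory Num.Theory.

Set Implicit Arguments.
Unset Strict Implicit.
Unset Printing Implicit Defensive.

#[export] Set Implicit Arguments.
#[export] Unset Strict Implicit.
#[export] Unset Printing Implicit Defensive.

Local Open Scope classical_set_scope.
Local Open Scope ring_scope.

(* R^m as a probability space is [m.-tuple R] with the library's product
   sigma-algebra; for its linear structure a point is read as a row vector. *)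
Definition vec (R : realType) (m : nat) (x : m.-tuple R) : 'rV[R]_m :=
  \row_i tnth x i.

Definition total (R : realType) (m : nat) (x : m.-tuple R) : R :=
  \sum_(i < m) tnth x i.

Record is_norm (R : realType) (V : lmodType R) (nrm : V -> R) : Prop := {
  is_norm_triangle : forall x y, nrm (x + y) <= nrm x + nrm y ;
  is_norm_homogeneous : forall c x, nrm (c *: x) = `|c| * nrm x ;
  is_norm_definite : forall x, nrm x = 0 -> x = 0 }.

(* [sup] is total; for a norm the set is nonempty and bounded above. *)
Definition dual_norm (R : realType) (m : nat) (nrm : 'rV[R]_m -> R)
    (b : 'rV[R]_m) : R :=
  sup [set `|\sum_(i < m) b 0 i * x 0 i| | x in [set x | nrm x <= 1]].

Section empirical.
Local Open Scope ereal_scope.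
Context d (T : measurableType d) (R : realType) (N : nat) (x : 'I_N -> T).

Definition empirical (A : set T) : \bar R :=
  (N%:R^-1)%:E * \sum_(n < N) \d_(x n) A.

Let empirical0 : empirical set0 = 0.
Proof. by rewrite /empirical big1 ?mule0. Qed.

Let empirical_ge0 A : 0 <= empirical A.
Proof. by rewrite mule_ge0 ?lee_fin ?invr_ge0// sume_ge0. Qed.

Let empirical_sigma_additive : semi_sigma_additive empirical.
Proof.
move=> F mF tF mUF; rewrite /empirical.
rewrite (_ : (fun n => _) = (fun n => (N%:R^-1)%:E *
    \sum_(0 <= i < n) \sum_(k < N) \d_(x k) (F i))); last first.
  by apply/funext => n; rewrite ge0_sume_distrr// => i _; exact: sume_ge0.
apply: cvgeZl => //; rewrite [X in _ --> X](_ : _ =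
    limn (fun n => \sum_(0 <= i < n) \sum_(k < N) \d_(x k) (F i))).
  by apply: is_cvg_ereal_nneg_natsum => k _; exact: sume_ge0.
rewrite nneseries_sum//; apply: eq_bigr => /= i _.
exact: measure_semi_bigcup.
Qed.

HB.instance Definition _ := isMeasure.Build _ _ _ empirical
  empirical0 empirical_ge0 empirical_sigma_additive.

End empirical.

Section wasserstein.
Local Open Scope ereal_scope.
Context (R : realType) (m : nat) (nrm : 'rV[R]_m -> R).

Definition coupling (mu nu : {measure set (m.-tuple R) -> \bar R}) :
    set (probability (m.-tuple R * m.-tuple R)%type R) :=
  [set Q | forall A, measurable A ->
    Q (A `*` setT) = mu A /\ Q (setT `*` A) = nu A].

Definition wasserstein (mu nu : {measure set (m.-tuple R) -> \bar R}) :
    \bar R :=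
  ereal_inf [set \int[Q]_xi (nrm (vec xi.1 - vec xi.2)%R)%:E
            | Q in coupling mu nu].

Definition ambiguity_set (N : nat) (x : 'I_N -> m.-tuple R) (delta : R) :
    set (probability (m.-tuple R) R) :=
  [set f : probability (m.-tuple R) R |
    f setT = 1 /\ wasserstein f (empirical R x) <= delta%:E].

End wasserstein.

(* The n-th largest sample total, for 1 <= n <= N (n is 1-based). *)
Definition sorted_total (R : realType) (m N : nat) (x : 'I_N -> m.-tuple R)
    (n : nat) : R :=
  nth 0 (sort >=%R [seq total (x j) | j <- enum 'I_N]) n.-1.

Definition load (R : realType) (L : nat) (P : 'I_L -> R) (u : 'I_L -> bool) :
    R :=
  \sum_(l < L) P l * (u l)%:R.

Definition dr_chance_constraint (R : realType) (L m N : nat)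
    (nrm : 'rV[R]_m -> R) (P : 'I_L -> R) (x : 'I_N -> m.-tuple R)
    (alpha delta : R) (u : 'I_L -> bool) : Prop :=
  ((1 - alpha)%:E <=
    ereal_inf [set f [set p : m.-tuple R | (0 <= load P u - total p)%R]
              | f in ambiguity_set nrm x delta])%E.

(* Only the entries 1, ..., k + 1 of the sequences a, h, M and M2 matter. *)
Definition milp_constraints (R : realType) (L m N : nat)
    (P : 'I_L -> R) (x : 'I_N -> m.-tuple R) (alpha delta : R) (k : nat)
    (M M2 : nat -> R) (u : 'I_L -> bool) (a : nat -> R) (h : nat -> bool) :
    Prop :=
  delta <= N%:R^-1 * (\sum_(1 <= n < k.+1) a n)
           + (alpha - k%:R / N%:R) * a k.+1 /\
  forall n, (1 <= n <= k.+1)%N ->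
    [/\ a n <= load P u - sorted_total x n + M2 n * (1 - (h n)%:R),
        a n <= M n * (h n)%:R &
        0 <= a n].

(* Main.v *)
From HB Require Import structures.
Require Import Defs.
From mathcomp Require Import ring lra measurable_realfun.
Local Open Scope classical_set_scope.
Local Open Scope ring_scope.

(** Fix a load [s]. The constraint fails at an outcome [p] when [total p > s],
    and since the dual norm of the all-ones vector is 1, a sample [p] must be
    moved by the positive part of [s - total p] to get there. An adversary with
    transport budget [delta] who wants a violation probability above [alpha]
    moves the nearest samples first, that is, those of largest total. Each
    sample has mass [1 / N], so with [k] the integer part of [alpha * N] a mass
    [alpha] takes the first [k] samples entirely and the mass [alpha - k / N]
    of the next one. The cost of this plan is [violation_cost], and both sides
    of the equivalence say that [delta] is at most this cost.

    For the chance constraint this is linear programming duality, proved by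
    hand. If [delta] is at most the cost, the pointwise inequality integrated
    in [coupling_cost_lower_bound] bounds the violation probability of every
    law in the ambiguity set ([violation_prob_le]). If [delta] exceeds the
    cost, a slightly larger mass than [alpha] can be moved within the budget
    ([exists_transport], [exists_violating_distribution]). The boundary case
    [delta] equal to the cost is on the feasible side because [delta > 0]
    forces the marginal sample to be at positive distance, so that any mass
    beyond [alpha] costs strictly more.

    For the linear constraints, the auxiliary variables encode the positive
    parts ([milp_violation_cost]). *)

(** * Samples in order of their totals *)

(** Sorting the samples themselves rather than their totals turns every
    statement about the order statistics into one about a single
    enumeration [sigma], which also reindexes the empirical measure. *)
Lemma sorted_total_enumeration (R : realType) (m N : nat)
    (x : 'I_N -> m.-tuple R) (i0 : 'I_N) :
  exists sigma : nat -> 'I_N,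
    [/\ perm_eq (enum 'I_N) (mkseq sigma N),
        forall n, (n < N)%N -> sorted_total x n.+1 = total (x (sigma n)) &
        forall n n', (n <= n' < N)%N ->
          sorted_total x n'.+1 <= sorted_total x n.+1].
Proof.
set r := sort (relpre (fun i => total (x i)) >=%R) (enum 'I_N).
have sz : size r = N by rewrite size_sort size_enum_ord.
have sE n : sorted_total x n.+1 = nth 0 [seq total (x j) | j <- r] n.
  by rewrite /sorted_total sort_map.
have sr : sorted >=%R [seq total (x j) | j <- r].
  by rewrite -sort_map; apply: sort_sorted => a b; exact: le_total.
exists (nth i0 r); split.
- by rewrite -[X in mkseq _ X]sz mkseq_nth perm_sym perm_sort.
- by move=> n nN; rewrite sE (nth_map i0) ?sz.
- move=> n n' /andP[nn' n'N]; rewrite !sE.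
  apply: (sorted_leq_nth (@rev_trans _ _ le_trans) (@lexx _ R) 0 sr) => //;
    by rewrite inE size_map sz//; exact: leq_ltn_trans n'N.
Qed.

Lemma sum_enumeration (V : nmodType) (N : nat) (sigma : nat -> 'I_N)
    (F : 'I_N -> V) :
  perm_eq (enum 'I_N) (mkseq sigma N) ->
  \sum_(i < N) F i = \sum_(n < N) F (sigma n).
Proof.
move=> s; rewrite -big_enum (perm_big _ s) /= big_map.
by rewrite -{1}[N]subn0 -/(index_iota 0 N) big_mkord.
Qed.

(** * The norm and its dual norm of the all-ones vector *)

Section norm.
Context (R : realType) (m : nat) (nrm : 'rV[R]_m -> R).
Context (hnrm : is_norm nrm).

Lemma is_norm0 : nrm 0 = 0.
Proof. by rewrite -(scale0r 0) is_norm_homogeneous// normr0 mul0r. Qed.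

Lemma is_norm_ge0 z : 0 <= nrm z.
Proof.
have := is_norm_triangle hnrm z (-1 *: z).
rewrite is_norm_homogeneous// normrN1 scaleN1r subrr is_norm0; lra.
Qed.

Context (hdual : dual_norm nrm (const_mx 1) = 1).

Let S := [set `|\sum_(i < m) (const_mx 1 : 'rV[R]_m) 0 i * x 0 i| | x in
  [set x | nrm x <= 1]].

(* An unbounded set has [sup] equal to 0, which [hdual] excludes: the value 1
   of the dual norm already carries its finiteness. *)
Let has_supS : has_sup S.
Proof.
apply: contrapT => /sup_out h; move: hdual; rewrite /dual_norm h => /eqP.
by rewrite eq_sym oner_eq0.
Qed.

Lemma sum_le_norm (z : 'rV[R]_m) : \sum_i z 0 i <= nrm z.
Proof.
have [z0|z0] := eqVneq (nrm z) 0.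
  rewrite z0 (is_norm_definite hnrm z0) big1// => i _; by rewrite mxE.
have zp : 0 < nrm z by rewrite lt_def z0 is_norm_ge0.
have : S `|\sum_(i < m) (const_mx 1 : 'rV[R]_m) 0 i * ((nrm z)^-1 *: z) 0 i|.
  exists ((nrm z)^-1 *: z) => //=; rewrite is_norm_homogeneous//.
  by rewrite ger0_norm ?invr_ge0 ?(ltW zp)// mulVf.
move=> /(sup_upper_bound has_supS); rewrite [sup S]hdual.
under eq_bigr do rewrite !mxE mul1r.
rewrite -mulr_sumr normrM normfV (gtr0_norm zp) ler_pdivrMl// mulr1.
by apply: le_trans; exact: ler_norm.
Qed.

(** The supremum defining the dual norm is only approached, so a direction
    that increases the total at unit rate costs up to [1 + eps] per unit. *)
Lemma exists_almost_dual_vector (eps : R) : 0 < eps ->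
  exists v : 'rV[R]_m, \sum_i v 0 i = 1 /\ nrm v <= 1 + eps.
Proof.
move=> e0; have e1 : 0 < 1 + eps by lra.
have [_ [z /= z1 <-]] := @sup_adherent _ S (eps / (1 + eps)) (divr_gt0 e0 e1) has_supS.
rewrite [sup S]hdual; have -> : 1 - eps / (1 + eps) = (1 + eps)^-1.
  by field; rewrite gt_eqF.
under eq_bigr do rewrite mxE mul1r.
set b := \sum_i z 0 i => hb.
have bp : 0 < `|b| by apply: lt_trans hb; rewrite invr_gt0.
exists (b^-1 *: z); split.
  by under eq_bigr do rewrite mxE; rewrite -mulr_sumr mulVf// -normr_gt0.
rewrite is_norm_homogeneous// normfV ler_pdivrMl//.
apply: (le_trans z1); rewrite -ler_pdivrMr// mul1r; exact: ltW.
Qed.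

Lemma total_sub_le_norm (y p : m.-tuple R) :
  total y - total p <= nrm (vec y - vec p).
Proof.
apply: le_trans (sum_le_norm _); rewrite /total -sumrB.
by under [leRHS]eq_bigr do rewrite !mxE.
Qed.

Lemma exists_shift (eps : R) : 0 < eps -> forall (p : m.-tuple R) (t : R),
  0 <= t -> exists y : m.-tuple R,
    total y = total p + t /\ nrm (vec y - vec p) <= (1 + eps) * t.
Proof.
move=> /exists_almost_dual_vector[v [v1 vn]] p t t0.
exists [tuple tnth p i + t * v 0 i | i < m]; split.
  rewrite /total; under eq_bigr do rewrite tnth_mktuple.
  by rewrite big_split /= -mulr_sumr v1 mulr1.
rewrite (_ : _ - _ = t *: v); last first.
  by apply/rowP => i; rewrite !mxE tnth_mktuple addrC addKr.
by rewrite is_norm_homogeneous// ger0_norm// mulrC ler_wpM2r.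
Qed.

End norm.

(** * Integrals of nonnegative functions that need not be measurable

    The transport cost is an arbitrary norm of a difference. Its integral can
    be handled without proving it measurable for the product sigma-algebra:
    the integral of a nonnegative function is a supremum over the measurable
    simple functions below it, which is enough for comparison and for an upper
    bound under a finitely supported measure. *)

Section integral.
Local Open Scope ereal_scope.
Context d (T : measurableType d) (R : realType).

Import HBNNSimple.

Lemma ge0_le_integralT (mu : {measure set T -> \bar R}) (f g : T -> \bar R) :
  (forall t, 0 <= f t) -> (forall t, f t <= g t) ->
  \int[mu]_t f t <= \int[mu]_t g t.
Proof.
move=> f0 fg; rewrite !ge0_integralTE//; last by move=> t; exact: le_trans (fg t).
apply: ereal_sup_le => _ [h /= hf <-]; exists h => //= t.
exact: le_trans (fg t).
Qed.

Lemma ge0_integral_le_nnsfun (mu : {measure set T -> \bar R}) (f : T -> \bar R)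
    (c : \bar R) : (forall t, 0 <= f t) ->
  (forall h : {nnsfun T >-> R}, (forall t, (h t)%:E <= f t) ->
    \int[mu]_t (h t)%:E <= c) ->
  \int[mu]_t f t <= c.
Proof.
move=> f0 hc; rewrite ge0_integralTE//; apply: ge_ereal_sup => _ [h /= hf <-].
by have := hc h hf; rewrite integral_nnsfun// patch_setT.
Qed.

Definition atoms (K : nat) (w : nat -> {nonneg R}) (p : nat -> T) :=
  msum (fun n => mscale (w n) (\d_(p n))) K.

HB.instance Definition _ K w p := Measure.on (atoms K w p).

Lemma atomsE K w p A : atoms K w p A = \sum_(n < K) (w n)%:num%:E * \d_(p n) A.
Proof. by []. Qed.

Lemma ge0_integral_atoms K w p (f : T -> \bar R) :
  measurable_fun setT f -> (forall t, 0 <= f t) ->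
  \int[atoms K w p]_t f t = \sum_(n < K) (w n)%:num%:E * f (p n).
Proof.
move=> mf f0; rewrite ge0_integral_measure_sum//.
apply: eq_bigr => n _; rewrite ge0_integral_mscale// integral_dirac//.
by rewrite diracT mul1e.
Qed.

Lemma ge0_integral_atomsD_le K w p w' p' (f : T -> \bar R) :
  (forall t, 0 <= f t) ->
  \int[measure_add (atoms K w p) (atoms K w' p')]_t f t <=
  \sum_(n < K) ((w n)%:num%:E * f (p n) + (w' n)%:num%:E * f (p' n)).
Proof.
move=> f0; apply: ge0_integral_le_nnsfun => // h hf.
have mh : measurable_fun setT (fun t => (h t)%:E) by exact/measurable_EFinP.
have h0 t : 0 <= (h t)%:E by rewrite lee_fin.
rewrite ge0_integral_measure_add// !ge0_integral_atoms// -big_split /=.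
by apply: lee_sum => n _; apply: leeD; apply: lee_wpmul2l => //; rewrite lee_fin.
Qed.

End integral.

(** * Transport to the violation half-space *)

Lemma measurable_total (R : realType) (m : nat) :
  measurable_fun setT (@total R m).
Proof. by apply: measurable_sum => i; exact: measurable_tnth. Qed.

Lemma measurable_violation (R : realType) (m : nat) (s : R) :
  measurable [set p : m.-tuple R | s < total p].
Proof.
have := @measurable_fun_ltr _ _ _ setT (cst s) (@total R m)
  (measurable_cst _) (@measurable_total R m) measurableT [set true].
rewrite setTI; exact.
Qed.

Lemma empirical_atoms (R : realType) d (T : measurableType d) (N : nat)
    (x : 'I_N -> T) (sigma : nat -> 'I_N) (w : {nonneg R}) A :
  perm_eq (enum 'I_N) (mkseq sigma N) -> w%:num = N%:R^-1 ->
  empirical R x A = atoms N (fun=> w) (x \o sigma) A.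
Proof.
move=> hs hw; rewrite /empirical atomsE hw (sum_enumeration _ hs).
by rewrite ge0_sume_distrr// => n _; rewrite measure_ge0.
Qed.

Lemma ge0_integral_empirical (R : realType) d (T : measurableType d) (N : nat)
    (x : 'I_N -> T) (sigma : nat -> 'I_N) (f : T -> R) :
  perm_eq (enum 'I_N) (mkseq sigma N) ->
  measurable_fun setT f -> (forall t, 0 <= f t) ->
  (\int[empirical R x]_t (f t)%:E)%E
    = (N%:R^-1 * \sum_(n < N) f (x (sigma n)))%:E.
Proof.
move=> hs mf f0; have w0 : 0 <= N%:R^-1 :> R by rewrite invr_ge0.
rewrite (eq_measure_integral (atoms N (fun=> NngNum w0) (x \o sigma))); last first.
  by move=> A _ _; exact: empirical_atoms.
rewrite ge0_integral_atoms//=; last exact/measurable_EFinP.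
by rewrite mulr_sumr -sumEFin; apply: eq_bigr => n _; rewrite EFinM.
Qed.

Section wasserstein_bound.
Context (R : realType) (m N : nat) (nrm : 'rV[R]_m -> R).
Context (x : 'I_N -> m.-tuple R) (sigma : nat -> 'I_N).
Context (hnrm : is_norm nrm) (hdual : dual_norm nrm (const_mx 1) = 1).
Context (hsigma : perm_eq (enum 'I_N) (mkseq sigma N)).
Implicit Type s : R.

(** Weak duality. Write [d p] for the positive part of [s - total p], a lower
    bound on the cost of moving [p] into the violation set [B]. Then
    [D * 1_B y <= nrm (y - p) + max 0 (D - d p)] for all [y] and [p]; integrate
    it against the coupling, whose marginals are [f] in [y] and the empirical
    distribution in [p]. *)
Lemma coupling_cost_lower_bound (f : probability (m.-tuple R) R) s (D : R) Q :
  0 <= D -> coupling f (empirical R x) Q ->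
  (D%:E * f [set p | (s < total p)%R] <=
   \int[Q]_xi (nrm (vec xi.1 - vec xi.2))%:E +
   (N%:R^-1 *
     \sum_(n < N) Num.max 0 (D - Num.max 0 (s - total (x (sigma n)))))%:E)%E.
Proof.
move=> D0 hQ.
set B := [set p | _]; have mB : measurable B by exact: measurable_violation.
pose phi (p : m.-tuple R) : R := Num.max 0 (D - Num.max 0 (s - total p)).
have mphi : measurable_fun setT phi.
  apply: measurable_maxr => //; apply: measurable_funB => //.
  apply: measurable_maxr => //; apply: measurable_funB => //.
  exact: measurable_total.
have phi0 p : 0 <= phi p by rewrite le_max lexx.
have mB1 : measurable_fun setT
    (fun xi : m.-tuple R * m.-tuple R => \1_B xi.1 : R).
  exact: (measurableT_comp (measurable_indic mB) measurable_fst).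
(* [h] is a measurable minorant of the transport cost, so the additivity of
   the integral is available for it. *)
pose h (xi : m.-tuple R * m.-tuple R) : R :=
  Num.max 0 (D * \1_B xi.1 - phi xi.2).
have mDB : measurable_fun setT
    (fun xi : m.-tuple R * m.-tuple R => D * \1_B xi.1).
  exact: measurable_funM.
have mphi2 : measurable_fun setT
    (fun xi : m.-tuple R * m.-tuple R => phi xi.2).
  by apply: measurableT_comp.
have mh : measurable_fun setT h.
  by apply: measurable_maxr => //; apply: measurable_funB.
have h0 xi : 0 <= h xi by rewrite le_max lexx.
have hcost xi : h xi <= nrm (vec xi.1 - vec xi.2).
  rewrite /h ge_max is_norm_ge0//= indicE.
  have := total_sub_le_norm hnrm hdual xi.1 xi.2.
  have := is_norm_ge0 hnrm (vec xi.1 - vec xi.2).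
  have := phi0 xi.2.
  case: (boolP (xi.1 \in B)) => [/set_mem sB|_]; last by rewrite mulr0; lra.
  rewrite mulr1 => _ nrm0 tot; have {}sB : s < total xi.1 := sB.
  have : D - Num.max 0 (s - total xi.2) <= phi xi.2 by rewrite le_max lexx orbT.
  have : Num.max 0 (s - total xi.2) <= nrm (vec xi.1 - vec xi.2).
    by rewrite ge_max nrm0 /=; lra.
  lra.
have -> : f B = Q (B `*` setT) by have [] := hQ _ mB.
have -> : (D%:E * Q (B `*` setT) = \int[Q]_xi (D * \1_B xi.1)%:E)%E.
  under eq_integral do rewrite EFinM.
  rewrite ge0_integralZl//; last first.
    exact/measurable_EFinP.
  congr (_ * _)%E.
  rewrite -[in LHS](setIT (_ `*` _)) -integral_indic//; last exact: measurableX.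
  apply: eq_integral => xi _; rewrite !indicE.
  by rewrite in_setX in_setT andbT.
have -> : (N%:R^-1 * \sum_(n < N)
    Num.max 0 (D - Num.max 0 (s - total (x (sigma n)))))%:E =
    (\int[Q]_xi (phi xi.2)%:E)%E.
  rewrite -(ge0_integral_empirical x hsigma mphi phi0).
  rewrite -(@ge0_integral_pushforward _ _ _ _ R snd measurable_snd Q setT
    (EFin \o phi))//; last 2 first.
  - exact/measurable_EFinP.
  - by move=> p _; rewrite lee_fin.
  apply: eq_measure_integral => A mA _ /=.
  rewrite /pushforward (_ : snd @^-1` A = setT `*` A).
    by have [_ ->] := hQ _ mA.
  by apply/seteqP; split => xi //= [].
apply: (@le_trans _ _ (\int[Q]_xi ((h xi)%:E + (phi xi.2)%:E))%E).
  apply: ge0_le_integralT => xi.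
    by rewrite lee_fin mulr_ge0// indicE.
  rewrite -EFinD lee_fin -lerBlDr /h le_max lexx orbT//.
rewrite ge0_integralD//; last 4 first.
- by move=> xi _; rewrite lee_fin.
- exact/measurable_EFinP.
- by move=> xi _; rewrite lee_fin.
- exact/measurable_EFinP.
apply: leeD => //; apply: ge0_le_integralT => xi; rewrite lee_fin//.
Qed.

(** The mass [w n] taken from the [n]-th sample is sent just beyond the
    hyperplane of total [s]; the excess [eps] is there because the violation
    set is open, so its boundary does not count. The law is the first marginal
    of the transport plan. *)
Lemma exists_transport s (w : nat -> R) (eps : R) : (0 < N)%N -> 0 < eps ->
  (forall n, 0 <= w n <= N%:R^-1) ->
  exists f : probability (m.-tuple R) R,
    ((\sum_(n < N) w n)%:E <= f [set p | (s < total p)%R])%E /\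
    (wasserstein nrm f (empirical R x) <=
      (\sum_(n < N) w n *
        ((1 + eps) * (Num.max 0 (s - total (x (sigma n))) + eps)))%:E)%E.
Proof.
move=> N0 e0 hw.
have w0 n : 0 <= w n by case/andP: (hw n).
have w'0 n : 0 <= N%:R^-1 - w n by rewrite subr_ge0; case/andP: (hw n).
pose q n := x (sigma n).
have /choice[y hy] n : exists y : m.-tuple R, s < total y /\
    nrm (vec y - vec (q n)) <= (1 + eps) * (Num.max 0 (s - total (q n)) + eps).
  have t0 : 0 <= Num.max 0 (s - total (q n)) + eps.
    by rewrite addr_ge0 ?le_max ?lexx// ltW.
  have [y [ty ny]] := exists_shift hnrm hdual e0 (q n) t0.
  exists y; split=> //; rewrite ty.
  have : s - total (q n) <= Num.max 0 (s - total (q n)).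
    by rewrite le_max lexx orbT.
  lra.
(* The diagonal pair [(q n, q n)] carries the mass that is not moved. *)
pose mu : {measure set (m.-tuple R * m.-tuple R)%type -> \bar R} := measure_add
  (atoms N (fun n => NngNum (w0 n)) (fun n => (y n, q n)))
  (atoms N (fun n => NngNum (w'0 n)) (fun n => (q n, q n))).
have muE A : mu A = (\sum_(n < N) ((w n)%:E * \d_(y n, q n) A +
    (N%:R^-1 - w n)%:E * \d_(q n, q n) A))%E.
  by rewrite big_split; exact: measure_addE.
have mu1 : mu setT = 1%E.
  rewrite muE; under eq_bigr do rewrite !diracT !mule1 -EFinD addrC subrK.
  rewrite sumEFin sumr_const card_ord -[_ *+ _]mulr_natr mulVf//.
  by rewrite pnatr_eq0 -lt0n.
pose Q : probability (m.-tuple R * m.-tuple R)%type R :=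
  HB.pack (Measure.sort mu) (Measure_isProbability.Build _ _ _ mu mu1).
pose fst' : {mfun (m.-tuple R * m.-tuple R)%type >-> m.-tuple R} :=
  HB.pack (fst : m.-tuple R * m.-tuple R -> m.-tuple R)
    (isMeasurableFun.Build _ _ _ _ _ measurable_fst).
exists (distribution Q fst'); split.
  rewrite -sumEFin [leRHS](_ : _ = mu (fst @^-1` [set p | s < total p]))//.
  rewrite muE; apply: lee_sum => n _.
  rewrite diracE mem_set ?mule1; last by have [] := hy n.
  by rewrite leeDl// mule_ge0// lee_fin.
apply: ge_ereal_inf; exists (\int[Q]_xi (nrm (vec xi.1 - vec xi.2))%:E)%E.
  exists Q => // A mA; split.
    rewrite /distribution /pushforward; congr (Q _).
    by apply/seteqP; split => xi //= [].
  have w0' : 0 <= N%:R^-1 :> R by rewrite invr_ge0.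
  transitivity (atoms N (fun=> NngNum w0') (x \o sigma) A); last first.
    by apply/esym; exact: empirical_atoms hsigma _.
  rewrite atomsE.
  rewrite [LHS]muE; apply: eq_bigr => n _ /=.
  by rewrite !diracE !in_setX !in_setT /= -ge0_muleDl ?lee_fin// -EFinD addrC subrK.
have cost0 (xi : m.-tuple R * m.-tuple R) :
    (0 <= (nrm (vec xi.1 - vec xi.2))%:E)%E by rewrite lee_fin is_norm_ge0.
apply: le_trans (ge0_integral_atomsD_le _ _ _ _ _ cost0) _.
rewrite -sumEFin; apply: lee_sum => n _ /=.
rewrite subrr (is_norm0 hnrm) mule0 adde0 -EFinM lee_fin.
by apply: ler_wpM2l => //; have [] := hy n.
Qed.

End wasserstein_bound.

(** * The cheapest way to violate with probability [alpha] *)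

(** The distance from the sample of [n]-th largest total to the violation set
    [total > s]; it is nondecreasing in [n] for [1 <= n <= N]. *)
Definition shortfall (R : realType) (m N : nat) (x : 'I_N -> m.-tuple R)
    (s : R) (n : nat) : R :=
  Num.max 0 (s - sorted_total x n).

(** The transport cost of a mass [alpha] sent to the violation set from the
    nearest samples first: [k] full atoms and a fraction of the next one. *)
Definition violation_cost (R : realType) (m N : nat) (x : 'I_N -> m.-tuple R)
    (s alpha : R) (k : nat) : R :=
  N%:R^-1 * (\sum_(1 <= n < k.+1) shortfall x s n)
  + (alpha - k%:R / N%:R) * shortfall x s k.+1.

Lemma quantile_index (R : realType) (N k : nat) (alpha : R) : (0 < N)%N ->
  alpha < 1 -> k%:Z = Num.floor (alpha * N%:R) ->
  (k < N)%N /\ 0 <= alpha - k%:R / N%:R < N%:R^-1.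
Proof.
move=> N0 a1 hk; have N0' : 0 < N%:R :> R by rewrite ltr0n.
have kle : k%:R <= alpha * N%:R.
  by have := floor_le_tmp (alpha * N%:R); rewrite -hk.
have klt : alpha * N%:R < k%:R + 1.
  by have := floorD1_gt (alpha * N%:R); rewrite -hk intrD.
split.
  by rewrite -(ltr_nat R); apply: (le_lt_trans kle); rewrite gtr_pMl.
rewrite subr_ge0 ler_pdivrMr// kle /= ltrBlDr -[X in X + _]mul1r -mulrDl.
by rewrite ltr_pdivlMr// addrC.
Qed.

Lemma sum_greedy_weights (R : realType) (N k : nat) (a b : R) (c : nat -> R) :
  (k < N)%N ->
  \sum_(n < N) (if (n < k)%N then a else if n == k :> nat then b else 0) * c n
    = a * (\sum_(n < k) c n) + b * c k.
Proof.
move=> kN.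
rewrite -(big_mkord xpredT
  (fun n => (if (n < k)%N then a else if n == k then b else 0) * c n)).
rewrite (big_cat_nat (leq0n k) (ltnW kN)) /= [X in _ + X]big_ltn//.
rewrite ltnn eqxx [X in _ + (_ + X)]big1_seq ?addr0; last first.
  move=> n /=; rewrite mem_index_iota => /andP[kn _].
  by rewrite ltnNge ltnW//= gtn_eqF// mul0r.
rewrite mulr_sumr big_mkord; congr (_ + _).
by apply: eq_bigr => i _; rewrite ltn_ord.
Qed.

Section chance.
Context (R : realType) (m N : nat) (nrm : 'rV[R]_m -> R).
Context (x : 'I_N -> m.-tuple R).
Context (hnrm : is_norm nrm) (hdual : dual_norm nrm (const_mx 1) = 1).
Context (alpha delta s : R) (k : nat).
Context (hdelta : 0 < delta).
Context (kN : (k < N)%N) (hk : 0 <= alpha - k%:R / N%:R < N%:R^-1).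

Let N0 : (0 < N)%N. Proof. exact: leq_ltn_trans kN. Qed.
Let N0' : 0 < N%:R^-1 :> R. Proof. by rewrite invr_gt0 ltr0n. Qed.

Let violation_costE : violation_cost x s alpha k =
  N%:R^-1 * (\sum_(n < k) shortfall x s n.+1)
  + (alpha - k%:R / N%:R) * shortfall x s k.+1.
Proof. by rewrite /violation_cost big_add1 big_mkord. Qed.

Let shortfall_ge0 n : 0 <= shortfall x s n.
Proof. by rewrite le_max lexx. Qed.

(** Weak duality at [D], the distance of the marginal sample [k + 1]: there the
    bound on the violation probability is an affine function of the radius
    that takes the value [alpha] exactly at [violation_cost]. *)
Lemma violation_prob_le (f : probability (m.-tuple R) R) :
  delta <= violation_cost x s alpha k ->
  ambiguity_set nrm x delta f ->
  (f [set p | (s < total p)%R] <= alpha%:E)%E.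
Proof.
move=> hC [_ hW].
have [sigma [hs st mono]] := sorted_total_enumeration x (Ordinal N0).
set D := shortfall x s k.+1.
have cmono n n' : (n <= n' < N)%N -> shortfall x s n.+1 <= shortfall x s n'.+1.
  move=> nn'; have := mono _ _ nn'; rewrite /shortfall => h.
  by rewrite ge_max le_max lexx /= le_max; apply/orP; right; lra.
have cD n : (n < k)%N -> shortfall x s n.+1 <= D.
  by move=> nk; apply: cmono; rewrite ltnW.
(* A zero distance at [k + 1] would force a zero violation cost, against
   [0 < delta]. *)
have D0 : 0 < D.
  rewrite lt_def shortfall_ge0 andbT; apply/eqP => D0.
  move: hC; rewrite violation_costE -/D D0 mulr0 addr0 big1 ?mulr0.
    by rewrite leNgt hdelta.
  by move=> n _; apply/eqP; rewrite eq_le shortfall_ge0 -D0 cD.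
pose K : R := N%:R^-1 *
  \sum_(n < N) Num.max 0 (D - Num.max 0 (s - total (x (sigma n)))).
have KE : K = N%:R^-1 * \sum_(n < k) (D - shortfall x s n.+1).
  congr (_ * _).
  rewrite [RHS](big_ord_widen N (fun n => D - shortfall x s n.+1) (ltnW kN)).
  rewrite [RHS]big_mkcond /=; apply: eq_bigr => n _.
  rewrite -st// -/(shortfall x s n.+1); case: ltnP => nk.
    by apply/max_idPr; rewrite subr_ge0 cD.
  by apply/max_idPl; rewrite subr_le0 cmono// nk /=.
have : (D%:E * f [set p | (s < total p)%R] - K%:E <=
    wasserstein nrm f (empirical R x))%E.
  apply: le_ereal_inf_tmp => _ [Q hQ <-]; rewrite leeBlDr//.
  exact (coupling_cost_lower_bound hnrm hdual hs s (ltW D0) hQ).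
move=> /le_trans /(_ hW); rewrite leeBlDr// -EFinD.
rewrite -(@fineK _ (f _)) ?fin_num_measure//; last exact: measurable_violation.
rewrite -EFinM !lee_fin => h; rewrite -(ler_pM2l D0); apply: (le_trans h).
have {}hC : delta <= N%:R^-1 * (\sum_(n < k) shortfall x s n.+1) +
  (alpha - k%:R / N%:R) * D by rewrite -violation_costE.
rewrite KE sumrB sumr_const card_ord -mulr_natr.
lra.
Qed.

(** When the greedy plan for mass [alpha] costs less than [delta], the
    remaining budget pays for three small excesses: [eps] more mass, [eps] more
    distance, and the factor [1 + eps] of a nearly optimal direction. *)
Lemma exists_violating_distribution :
  violation_cost x s alpha k < delta ->
  exists2 f : probability (m.-tuple R) R,
    ambiguity_set nrm x delta f & (alpha%:E < f [set p | (s < total p)%R])%E.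
Proof.
move=> hC.
have [sigma [hs st _]] := sorted_total_enumeration x (Ordinal N0).
set C := violation_cost _ _ _ _ in hC.
set D := shortfall x s k.+1.
have D0 : 0 <= D := shortfall_ge0 _.
pose b := alpha - k%:R / N%:R.
have [b0 b1] : 0 <= b /\ b < N%:R^-1 by apply/andP.
have C0 : 0 <= C.
  rewrite /C violation_costE addr_ge0// mulr_ge0//; last exact: sumr_ge0.
(* The bounds on [eps] keep the mass taken from sample [k + 1] below [1 / N]
   and, with [alpha + eps <= 1] and [eps <= 1], the cost
   [(1 + eps) * (C + eps * D + eps * (alpha + eps))] below
   [C + eps * (C + 2 * D + 2)]. *)
pose eps := Num.min (Num.min 1 (N%:R^-1 - b)) ((delta - C) / (C + 2 * D + 2)).
have den0 : 0 < C + 2 * D + 2 by lra.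
have e0 : 0 < eps.
  by rewrite !lt_min ltr01 subr_gt0 b1 /= divr_gt0// subr_gt0.
have e1 : eps <= 1 by rewrite !ge_min lexx.
have eb : eps <= N%:R^-1 - b by rewrite !ge_min lexx orbT.
have ed : eps * (C + 2 * D + 2) <= delta - C.
  by rewrite -ler_pdivlMr// ge_min lexx orbT.
pose w n := if (n < k)%N then N%:R^-1 else if n == k then b + eps else 0 : R.
have hw n : 0 <= w n <= N%:R^-1.
  have := N0'; rewrite /w => ?.
  by case: ifP => _; [|case: ifP => _]; apply/andP; split; lra.
have [f [fB fW]] := exists_transport x hnrm hdual hs s N0 e0 hw.
have wS (c : nat -> R) : \sum_(n < N) w n * c n =
    N%:R^-1 * (\sum_(n < k) c n) + (b + eps) * c k.
  exact: sum_greedy_weights.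
have wsum : \sum_(n < N) w n = alpha + eps.
  under eq_bigr do rewrite -[w _]mulr1.
  rewrite (wS (fun=> 1)) sumr_const card_ord mulr1.
  by rewrite /b mulrC addrA addrCA subrr addr0.
exists f; last first.
  by apply: lt_le_trans fB; rewrite lte_fin wsum ltrDl.
split; first exact: probability_setT.
apply: (le_trans fW); rewrite lee_fin.
have -> : \sum_(n < N) w n *
    ((1 + eps) * (Num.max 0 (s - total (x (sigma n))) + eps)) =
  (1 + eps) * (\sum_(n < N) w n * shortfall x s n.+1 + eps * \sum_(n < N) w n).
  rewrite mulr_sumr -big_split mulr_sumr /=; apply: eq_bigr => n _.
  by rewrite /shortfall st//; ring.
rewrite (wS (fun n => shortfall x s n.+1)) wsum.
have -> : N%:R^-1 * (\sum_(n < k) shortfall x s n.+1) +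
    (b + eps) * shortfall x s k.+1 = C + eps * D.
  by rewrite /C violation_costE -/b -/D; ring.
have a1 : alpha + eps <= 1.
  have : k%:R / N%:R + N%:R^-1 <= 1 :> R.
    by rewrite -[X in _ + X]mul1r -mulrDl natr1 ler_pdivrMr ?ltr0n// mul1r ler_nat.
  by move: eb; rewrite /b; lra.
have : eps * (alpha + eps) <= eps by rewrite ler_piMr// ltW.
have eD : eps * eps * D <= eps * D.
  by rewrite ler_wpM2r// ler_piMl// ltW.
have ee : eps * (eps * (alpha + eps)) <= eps.
  apply: (@le_trans _ _ (eps * eps)); last by rewrite ler_piMl// ltW.
  by rewrite ler_wpM2l ?(ltW e0)// ler_piMr// ltW.
nra.
Qed.

Lemma chance_constraint_violation_cost :
  ((1 - alpha)%:E <= ereal_inf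
    [set f [set p : m.-tuple R | (0 <= s - total p)%R]
    | f in ambiguity_set nrm x delta])%E <->
  delta <= violation_cost x s alpha k.
Proof.
have goodE : [set p : m.-tuple R | 0 <= s - total p] =
    ~` [set p | s < total p].
  by apply/seteqP; split=> p /=; rewrite subr_ge0 leNgt => /negP.
have mV := @measurable_violation R m s.
split=> h.
  rewrite leNgt; apply/negP => /exists_violating_distribution[f hf].
  apply/negP; rewrite -leNgt.
  have : ((1 - alpha)%:E <= f [set p : m.-tuple R | (0 <= s - total p)%R])%E.
    by apply: le_trans h _; apply: ereal_inf_lbound; exists f.
  rewrite goodE probability_setC// -(@fineK _ (f _)) ?fin_num_measure//.
  by rewrite -EFinB !lee_fin; lra.
apply: le_ereal_inf_tmp => _ [f hf <-].
have := violation_prob_le h hf.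
rewrite goodE probability_setC// -(@fineK _ (f _)) ?fin_num_measure//.
by rewrite -EFinB !lee_fin; lra.
Qed.

End chance.

(** * The mixed-integer reformulation *)

(** The constraints on [a n] and [h n] say that [a n] is at most the shortfall:
    [h n] selects the active branch of the positive part, and the bounds on
    [M] and [M2] make the other branch inactive. Since the coefficients of the
    budget constraint are nonnegative, the shortfalls themselves are the best
    choice of [a]. *)
Lemma milp_violation_cost (R : realType) (L m N : nat) (P : 'I_L -> R)
    (x : 'I_N -> m.-tuple R) (alpha delta : R) (k : nat) (M M2 : nat -> R)
    (u : 'I_L -> bool) :
  0 <= alpha - k%:R / N%:R ->
  (forall n, (1 <= n <= k.+1)%N ->
    `|load P u - sorted_total x n| <= M n /\
    `|load P u - sorted_total x n| <= M2 n) ->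
  (exists (a : nat -> R) (h : nat -> bool),
    milp_constraints P x alpha delta k M M2 u a h) <->
  delta <= violation_cost x (load P u) alpha k.
Proof.
move=> b0 hM; split=> [[a [h [ha hah]]]|hC].
  have asf n : (1 <= n <= k.+1)%N -> a n <= shortfall x (load P u) n.
    move=> /hah[h1 h2 _]; rewrite le_max; move: h1 h2.
    case: (h n) => /=; rewrite ?subrr ?mulr0 ?addr0 => h1 h2.
      by rewrite h1 orbT.
    by rewrite h2.
  apply: (le_trans ha); apply: lerD; last first.
    by apply: ler_wpM2l => //; apply: asf; rewrite leqnn.
  rewrite ler_wpM2l ?invr_ge0//.
  by apply: ler_sum_nat => n /andP[n1 nk]; apply: asf; rewrite n1 ltnW.
exists (shortfall x (load P u)), (fun n => 0 <= load P u - sorted_total x n).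
split=> // n /hM[h1 h2]; rewrite /shortfall.
have := ler_norm (load P u - sorted_total x n).
have := ler_norm (- (load P u - sorted_total x n)); rewrite normrN => l1 l2.
case: (lerP 0 (load P u - sorted_total x n)) => h /=; rewrite ?subrr ?mulr0 ?addr0 ?subr0 ?mulr1; split=> //; lra.
Qed.

Theorem theorem1 (R : realType) (NHVAC NPV N : nat)
    (hHVAC : (1 <= NHVAC)%N) (hPV : (1 <= NPV)%N) (hN : (1 <= N)%N)
    (nrm : 'rV[R]_NPV -> R) (hnrm : is_norm nrm)
    (hdual : dual_norm nrm (const_mx 1) = 1)
    (P : 'I_NHVAC -> R) (x : 'I_N -> NPV.-tuple R)
    (alpha delta : R) (halpha : 0 < alpha < 1) (hdelta : 0 < delta)
    (hP : sorted_total x N < \sum_(l < NHVAC) P l)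
    (k : nat) (hk : k%:Z = Num.floor (alpha * N%:R)) :
  exists M0 : R, forall M M2 : nat -> R,
    (forall n, (1 <= n <= k.+1)%N -> M0 <= M n /\ M0 <= M2 n) ->
    forall u : 'I_NHVAC -> bool,
      dr_chance_constraint nrm P x alpha delta u <->
      exists (a : nat -> R) (h : nat -> bool),
        milp_constraints P x alpha delta k M M2 u a h.
Proof.
have [_ a1] := andP halpha; have [kN hb] := quantile_index hN a1 hk.
(* One bound for every decision [u]: the load is at most [\sum_l `|P l|] in
   absolute value. *)
exists (\sum_l `|P l| + \sum_(1 <= n < k.+2) `|sorted_total x n|).
move=> M M2 hM u.
have bound n : (1 <= n <= k.+1)%N -> `|load P u - sorted_total x n| <=
    \sum_l `|P l| + \sum_(1 <= n < k.+2) `|sorted_total x n|.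
  move=> hn; apply: (le_trans (ler_normB _ _)); apply: lerD.
    apply: (le_trans (ler_norm_sum _ _ _)); apply: ler_sum => l _.
    by rewrite normrM ler_piMr//; case: (u l); rewrite ?normr1 ?normr0.
  rewrite (bigD1_seq n) ?iota_uniq ?mem_index_iota//= lerDl.
  by apply: sumr_ge0.
rewrite milp_violation_cost.
- exact: chance_constraint_violation_cost.
- by case/andP: hb.
- by move=> n hn; have [h1 h2] := hM n hn; split; apply: le_trans (bound n hn) _.
Qed.
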